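(* Let $l\ge1$. For each finite word $w=w_1\cdots w_n$ over $\mathbb{N}=\{0,1,2,\dots\}$ (including the empty word, of weight $1$) define its weight $\Psi(w)=\prod_{i=1}^n\mathrm{wt}_i(w)$, where, writing $w_i=ul+m$ with $u\ge0$ and $0\le m\le l-1$: (a) if $i$ is a decrease of $w$: $\mathrm{wt}_i(w)=tY_{u-1}$ if $m=0$, and $\mathrm{wt}_i(w)=s_mY_u$ if $m\ge1$; (b) if $i$ is an increase but not a record of $w$: $\mathrm{wt}_i(w)=Y_u$ if $m=0$, and $s_mY_u$ if $m\ge1$; (c) if $i$ is an increase and a record of $w$: $\mathrm{wt}_i(w)=r_0Y_u$ if $m=0$, and $r_ms_mY_u$ if $m\ge1$. Then, as formal power series in $Y_0,Y_1,\dots$ with coefficients in $\mathbb{Q}(t,r_0,\dots,r_{l-1},s_1,\dots,s_{l-1})$, $$\lim_{r\rightarrow\infty}\sum_{w\in[0,r]^*}\Psi(w)=\frac{H(r_0Y)(1-t)\prod_{m=1}^{l-1}E(-s_mY)H(r_ms_mY)}{\bigl(1+\sum_{m=1}^{l-1}s_m\bigr)H(tY)-\bigl(t+\sum_{m=1}^{l-1}s_m\bigr)H(Y)},$$ where $[0,r]^*$ is the set of finite words over $\{0,1,\dots,r\}$, $H(aY)=\prod_{i\geq0}(1-aY_i)^{-1}$ and $E(aY)=\prod_{i\geq0}(1+aY_i)$.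
   Context: For a word $w=w_1\cdots w_n$ over $\mathbb{N}$: an index $i\in[n-1]$ is a decrease of $w$ if $w_i=w_{i+1}=\cdots=w_j>w_{j+1}$ for some $j$ with $i\le j\le n-1$; an index $i\in[n]$ is an increase if it is not a decrease (so $n$ is always an increase); an index $i$ is a record if $w_i\ge w_j$ for all $1\le j\le i-1$. Note that if $i$ is a decrease then $w_i\ge1$, so in case (a) with $m=0$ one has $u\ge1$. *)

(* Defs.v *)
From HB Require Import structures.
From mathcomp Require Import all_boot all_order all_algebra.
From mathcomp Require Import fraction.
From mathcomp Require Import mpoly.
Set Implicit Arguments. Unset Strict Implicit. Unset Printing Implicit Defensive.
Import Order.TTheory GRing.Theory Num.Theory.
Local Open Scope ring_scope.

(* 2l indeterminates: index 0 = t, index 1+m = r_m (m < l),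
   index l+m = s_m (1 <= m <= l-1).  (index l, i.e. "s_0", is unused). *)
Definition Kfield (l : nat) := {fraction {mpoly rat[(2 * l)%N]}}.

Definition indet (l i : nat) : Kfield l :=
  FracField.tofrac (if (insub i : option 'I_(2 * l)) is Some j then 'X_j else 0).

Definition par_t (l : nat) : Kfield l := indet l 0.
Definition par_r (l m : nat) : Kfield l := indet l m.+1.
Definition par_s (l m : nat) : Kfield l := indet l (l + m).

(* A monomial Y_{i_1} ... Y_{i_n} is encoded by the sorted (nondecreasing)
   list [:: i_1; ...; i_n] of its indices (with multiplicity).  A series is
   a function giving the coefficient of each (sorted) monomial; values on
   non-sorted lists are irrelevant. *)
Definition series (K : Type) := seq nat -> K.

Definition monom (s : seq nat) : seq nat := sort leq s.

Section Series.
Variable K : fieldType.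

Definition seq_eq (F G : series K) : Prop :=
  forall m, sorted leq m -> F m = G m.

Definition sconst (c : K) : series K := fun m => if m is [::] then c else 0.
Definition sadd (F G : series K) : series K := fun m => F m + G m.
Definition sopp (F : series K) : series K := fun m => - F m.
Definition sscale (c : K) (F : series K) : series K := fun m => c * F m.

Fixpoint bits (n : nat) : seq bitseq :=
  if n is k.+1 then [seq true :: b | b <- bits k] ++ [seq false :: b | b <- bits k]
  else [:: [::]].

Definition splits (m : seq nat) : seq (seq nat * seq nat) :=
  undup [seq (mask b m, mask (map negb b) m) | b <- bits (size m)].

Definition smul (F G : series K) : series K :=
  fun m => \sum_(p <- splits m) F p.1 * G p.2.

Definition sprod (Fs : seq (series K)) : series K := foldr smul (sconst 1) Fs.

(* H(aY) = prod_{i>=0} (1 - a Y_i)^{-1} = sum over all monomials Y^alpha of a^{|alpha|} *)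
Definition Hser (a : K) : series K := fun m => a ^+ size m.
(* E(aY) = prod_{i>=0} (1 + a Y_i) = sum over squarefree monomials of a^{|alpha|} *)
Definition Eser (a : K) : series K := fun m => if uniq m then a ^+ size m else 0.

Definition series_lim (S : nat -> series K) (F : series K) : Prop :=
  forall m, sorted leq m -> exists R, forall r, (R <= r)%N -> S r m = F m.
End Series.

(* positions are 0-indexed: position i here is index i+1 of the paper *)
Definition letter (w : seq nat) (i : nat) : nat := nth 0%N w i.

Definition is_decrease (w : seq nat) (i : nat) : bool :=
  has (fun j => [&& (i <= j)%N,
                    all (fun k => letter w k == letter w i) (iota i (j - i).+1)
                  & (letter w j.+1 < letter w j)%N])
      (iota 0 (size w).-1).

Definition is_increase (w : seq nat) (i : nat) : bool :=
  (i < size w)%N && ~~ is_decrease w i.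

Definition is_record (w : seq nat) (i : nat) : bool :=
  all (fun j => (letter w j <= letter w i)%N) (iota 0 i).

(* ---------- The weight wt_i(w) = (coefficient) * Y_(index) ---------- *)
Section Weight.
Variable l : nat.

Definition wt_coef (w : seq nat) (i : nat) : Kfield l :=
  let u := (letter w i %/ l)%N in
  let m := (letter w i %% l)%N in
  if is_decrease w i then
    (if m == 0%N then par_t l else par_s l m)
  else if is_record w i then
    (if m == 0%N then par_r l 0 else par_r l m * par_s l m)
  else
    (if m == 0%N then 1 else par_s l m).

Definition wt_index (w : seq nat) (i : nat) : nat :=
  let u := (letter w i %/ l)%N in
  let m := (letter w i %% l)%N in
  if is_decrease w i && (m == 0%N) then u.-1 else u.

Definition psi_coef (w : seq nat) : Kfield l :=
  \prod_(0 <= i < size w) wt_coef w i.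
Definition psi_mon (w : seq nat) : seq nat :=
  monom [seq wt_index w i | i <- iota 0 (size w)].

Fixpoint words (r n : nat) : seq (seq nat) :=
  if n is k.+1 then [seq a :: x | a <- iota 0 r.+1, x <- words r k]
  else [:: [::]].

(* sum_{w in [0,r]^*} Psi(w), coefficient of the sorted monomial m
   (only words of length size m can contribute to m) *)
Definition psum (r : nat) : series (Kfield l) :=
  fun m => \sum_(w <- words r (size m) | psi_mon w == m) psi_coef w.

Definition numer : series (Kfield l) :=
  sprod (Hser (par_r l 0) :: sconst (1 - par_t l) ::
         [seq smul (Eser (- par_s l m)) (Hser (par_r l m * par_s l m))
         | m <- iota 1 l.-1]).

Definition denom : series (Kfield l) :=
  let S := \sum_(1 <= m < l) par_s l m in
  sadd (sscale (1 + S) (Hser (par_t l))) (sopp (sscale (par_t l + S) (Hser 1))).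
End Weight.

(* Main.v *)
Require Import Defs.
From HB Require Import structures.
From mathcomp Require Import all_boot all_order all_algebra.
From mathcomp Require Import fraction.
From mathcomp Require Import mpoly.
From mathcomp Require Import ring zify.
Set Implicit Arguments. Unset Strict Implicit. Unset Printing Implicit Defensive.
Import GRing.Theory.
Local Open Scope ring_scope.

(* Give a letter a the weight x_a, y_a or z_a when it is a decrease, a
   non-record increase or a record increase.  Process words from the left,
   remembering the running maximum M, and let W_M be the weighted sum of all
   words over [0, L) read in state M, and U_a (in state M) the part of W_M
   coming from the empty word and the words with first letter >= a.
   Splitting by the first letter gives, for a <= M,
     (1 - x_a) U_{a+1} = (1 - w_a) (U_a - x_a W_M),
   with w_a = z_a if a = M and w_a = y_a otherwise.  Since a letter above M
   only depends on the state it creates, the states M and M+1 share the same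
   U_{M+1}; comparing the two recursions yields
     (1 - y_M) W_{M+1} = (1 - z_M) W_M,
   hence W_0 k_L prod (1 - z_a) = prod (1 - x_a) prod (1 - y_a), where
   k_{a+1} = (1 - y_a) (k_a - x_a prod_{i<a} (1 - x_i)).
   For the weights of the theorem, k_L telescopes over blocks of l letters.
   A coefficient of the series only involves finitely many Y_u, so everything
   is computed in polynomials in Y_0, ..., Y_{N-1} (with Y_u = 0 for u >= N)
   modulo terms of degree > n. *)

(** * First-letter recursion, modulo an ideal *)

(** This is k_a of the overview: for a <= M, solving the recursion in state M gives U_a prod_{i<a}
    (1 - x_i) = W_M k_a. The weights z do not enter, since no letter below M is a record. *)
Fixpoint kernel (A : comNzRingType) (x y : nat -> A) (n : nat) : A :=
  if n is a.+1
  then (1 - y a) * (kernel x y a - x a * \prod_(0 <= i < a) (1 - x i)) else 1.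

Section FirstLetter.
Variables (A : comNzRingType) (J : A -> Prop).
Hypothesis J0 : J 0.
Hypothesis JD : forall a b, J a -> J b -> J (a + b).
Hypothesis JM : forall c a, J a -> J (c * a).

(** In state M, [g M a] stands for the words starting with a, and [gd M a], [gi M a] for the tails v
    of those words a v in which a is a decrease, respectively an increase. A decrease is followed by
    a smaller letter or by an equal decrease; an increase by nothing, a larger letter or an equal
    increase. *)
Variables (L : nat) (x y z : nat -> A) (g gd gi : nat -> nat -> A).
Let w M a := if (M <= a)%N then z a else y a.
Hypothesis g_split : forall M a, (a <= M)%N -> (a < L)%N ->
  J (g M a - (x a * gd M a + w M a * gi M a)).
Hypothesis gd_eq : forall M a, (a <= M)%N -> (a < L)%N ->
  J ((1 - x a) * gd M a - \sum_(0 <= b < a) g M b).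
Hypothesis gi_eq : forall M a, (a <= M)%N -> (a < L)%N ->
  J ((1 - w M a) * gi M a - (1 + \sum_(a.+1 <= b < L) g M b)).
Hypothesis g_record : forall M a, (M <= a)%N -> g M a = g a a.

Let p a := \prod_(0 <= i < a) (1 - x i).
Let k := kernel x y.
Hypothesis k_cancel : forall a c, J (c * (k a - x a * p a)) -> J c.

Let U M a := 1 + \sum_(a <= b < L) g M b.

(** Multiplying [g_split] by (1 - x_a)(1 - w_a) eliminates [gd] and [gi]; then g_a = U_a - U_{a+1},
    and the words starting below a sum to W_M - U_a. *)
Let U_step M a : (a <= M)%N -> (a < L)%N ->
  J ((1 - x a) * U M a.+1 - (1 - w M a) * (U M a - x a * U M 0)).
Proof.
move=> aM aL.
have := g_split aM aL; have := gd_eq aM aL; have := gi_eq aM aL.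
have -> : U M 0 = U M a + \sum_(0 <= b < a) g M b.
  by rewrite /U (@big_cat_nat _ _ _ a) ?(ltnW aL) //=; ring.
have -> : U M a = U M a.+1 + g M a.
  by rewrite /U (big_ltn aL); ring.
rewrite -/(U M a.+1); set T := \sum_(_ <= _ < _) _; set V := U M a.+1.
set G := g M a; set D := gd M a; set I := gi M a; set c := w M a.
move=> hI hD hG.
have -> : (1 - x a) * V - (1 - c) * (V + G - x a * (V + G + T)) =
  - ((1 - c) * (1 - x a)) * (G - (x a * D + c * I))
  + (- (1 - c) * x a * ((1 - x a) * D - T)
     + - (1 - x a) * c * ((1 - c) * I - V)) by ring.
by apply: JD; [apply: JM | apply: JD; apply: JM].
Qed.

Let U_kernel M a : (a <= M)%N -> (a <= L)%N -> J (p a * U M a - U M 0 * k a).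
Proof.
elim: a => [|a IH] aM aL; first by rewrite /p big_nil /k /= mul1r mulr1 subrr.
have := U_step (ltnW aM) aL; have := IH (ltnW aM) (ltnW aL).
rewrite /w leqNgt aM /= => h1 h2.
rewrite {1}/p big_nat_recr //= -/(p a).
have -> : p a * (1 - x a) * U M a.+1 - U M 0 * ((1 - y a) * (k a - x a * p a)) =
  p a * ((1 - x a) * U M a.+1 - (1 - y a) * (U M a - x a * U M 0))
  + (1 - y a) * (p a * U M a - U M 0 * k a) by ring.
by apply: JD; apply: JM.
Qed.

(** Evaluate U_{M+1} in state M+1 by the kernel and in state M by one record step. Both results
    contain k_M - x_M p_M, which [k_cancel] removes. *)
Let U_next M : (M < L)%N -> J ((1 - y M) * U M.+1 0 - (1 - z M) * U M 0).
Proof.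
move=> ML; apply: (@k_cancel M).
have h1 := U_kernel (leqnn M) (ltnW ML).
have h2 := U_kernel (leqnn M.+1) ML.
have := U_step (leqnn M) ML; rewrite /w leqnn => h3.
have e : U M.+1 M.+1 = U M M.+1.
  congr (1 + _); apply: eq_big_nat => b /andP[Mb _].
  by rewrite g_record // (g_record (ltnW Mb)).
move: h2; rewrite e /p big_nat_recr //= -/(p M) => h2.
have -> : ((1 - y M) * U M.+1 0 - (1 - z M) * U M 0) * (k M - x M * p M) =
  -1 * (p M * (1 - x M) * U M M.+1 - U M.+1 0 * ((1 - y M) * (k M - x M * p M)))
  + (p M * ((1 - x M) * U M M.+1 - (1 - z M) * (U M M - x M * U M 0))
  + (1 - z M) * (p M * U M M - U M 0 * k M)) by ring.
by apply: JD; [apply: JM | apply: JD; apply: JM].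
Qed.

Lemma word_sum_kernel :
  J ((1 + \sum_(0 <= b < L) g 0 b) * k L * \prod_(0 <= i < L) (1 - z i)
     - \prod_(0 <= i < L) (1 - x i) * \prod_(0 <= i < L) (1 - y i)).
Proof.
have h M : (M <= L)%N -> J (\prod_(0 <= i < M) (1 - y i) * U M 0
    - \prod_(0 <= i < M) (1 - z i) * U 0 0).
  elim: M => [|M IH] ML; first by rewrite !big_nil subrr.
  rewrite !big_nat_recr //=.
  set py := \prod_(_ <= _ < _) _; set pz := \prod_(_ <= _ < _) _.
  have -> : py * (1 - y M) * U M.+1 0 - pz * (1 - z M) * U 0 0 =
    py * ((1 - y M) * U M.+1 0 - (1 - z M) * U M 0)
    + (1 - z M) * (py * U M 0 - pz * U 0 0) by ring.
  by apply: JD; apply: JM; [apply: U_next | apply/IH/ltnW].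
have := U_kernel (leqnn L) (leqnn L); have := h _ (leqnn L).
(* No letter of the alphabet reaches L, so in state L the kernel identity reads p_L = W_L k_L. *)
have -> : U L L = 1 by rewrite /U big_geq // addr0.
rewrite -/(U 0 0) -/(p L) mulr1.
set py := \prod_(_ <= _ < _) _; set pz := \prod_(_ <= _ < _) _ => h1 h2.
have -> : U 0 0 * k L * pz - p L * py =
  - k L * (py * U L 0 - pz * U 0 0) + - py * (p L - U L 0 * k L) by ring.
by apply: JD; apply: JM.
Qed.
End FirstLetter.

(** * Evaluation of the kernel over blocks of l letters *)

(* The alphabet is read in blocks: letter [u * l + m] has residue [m] and
   quotient [u]; the prefix stops after residue [c] of block [u]. *)
Lemma prod_blocks (A : comNzRingType) (l : nat) (F : nat -> A) (u c : nat) :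
  (0 < l)%N -> (c < l)%N ->
  \prod_(0 <= j < (u * l + c).+1) F j =
  \prod_(0 <= v < u.+1) F (v * l)%N
  * \prod_(0 <= v < u) \prod_(1 <= m < l) F (v * l + m)%N
  * \prod_(1 <= m < c.+1) F (u * l + m)%N.
Proof.
move=> l0; elim: u c => [|u IHu] c cl.
  by rewrite big_nat1 big_nil mulr1 mul0n add0n big_ltn.
elim: c cl => [_|c IHc cl].
  have -> : ((u.+1 * l + 0).+1 = (u * l + l.-1).+2)%N by lia.
  rewrite big_nat_recr //= IHu ?prednK // [X in _ = X * _ * _]big_nat_recr //=.
  rewrite [X in _ = _ * X * _]big_nat_recr //= [X in _ = _ * X]big_geq // mulr1.
  have -> : (u * l + l.-1).+1 = (u.+1 * l)%N by lia.
  by ring.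
rewrite addnS big_nat_recr //= IHc ?(ltnW cl) //.
by rewrite [X in _ = _ * X]big_nat_recr //= -addnS !mulrA.
Qed.

(* Closed form of the recursion at every letter; the last factor telescopes
   from one block to the next. *)
Lemma kernel_blocks (A : comNzRingType) (l : nat) (t : A) (s Y x y : nat -> A)
    (u c : nat) :
  (0 < l)%N -> (c < l)%N ->
  x 0%N = 0 -> (forall v, x (v.+1 * l)%N = t * Y v) ->
  (forall v, y (v * l)%N = Y v) ->
  (forall v m, (0 < m < l)%N -> x (v * l + m)%N = s m * Y v) ->
  (forall v m, (0 < m < l)%N -> y (v * l + m)%N = s m * Y v) ->
  let S := \sum_(1 <= m < l) s m in
  let T := \prod_(0 <= v < u) (1 - t * Y v) in
  (1 - t) * kernel x y (u * l + c).+1 =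
  \prod_(0 <= v < u) \prod_(1 <= m < l) (1 - s m * Y v)
  * \prod_(1 <= m < c.+1) (1 - s m * Y u)
  * ((1 + S) * \prod_(0 <= v < u.+1) (1 - Y v)
     - (t + S) * T * (1 - Y u)
     - (1 - t) * (\sum_(1 <= m < c.+1) s m) * Y u * T).
Proof.
move=> l0 cl x0 xl yl xm ym S T.
have px v d : (d < l)%N -> \prod_(0 <= i < (v * l + d).+1) (1 - x i) =
    \prod_(0 <= j < v) (1 - t * Y j)
    * \prod_(0 <= j < v) \prod_(1 <= m < l) (1 - s m * Y j)
    * \prod_(1 <= m < d.+1) (1 - s m * Y v).
  move=> dl; rewrite prod_blocks // big_nat_recl //= mul0n x0 subr0 mul1r.
  congr (_ * _ * _).
  - by apply: eq_bigr => j _; rewrite xl.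
  - by apply: eq_bigr => j _; apply: eq_big_nat => m hm; rewrite xm.
  - by apply: eq_big_nat => m hm; rewrite xm //; lia.
have xS v d : (d.+1 < l)%N -> x (v * l + d).+1 = s d.+1 * Y v.
  by move=> dl; rewrite -addnS xm.
have yS v d : (d.+1 < l)%N -> y (v * l + d).+1 = s d.+1 * Y v.
  by move=> dl; rewrite -addnS ym.
rewrite {}/T; elim: u c cl => [|u IHu] c cl; last first.
  elim: c cl => [_|c IHc cl].
    (* Entering block u+1 from the last residue l-1 of block u: subtracting the decrease term t Y_u
       p turns the non-B part of the bracket into - (t + S) T_u (1 - t Y_u), which is the
       telescoping. *)
    have -> : ((u.+1 * l + 0).+1 = (u * l + l.-1).+2)%N by lia.
    have l1 : (l.-1 < l)%N by lia.
    rewrite [kernel _ _ _.+2]/= -/(kernel x y (u * l + l.-1).+1).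
    rewrite px //; have := IHu _ l1.
    have -> : (u * l + l.-1).+1 = (u.+1 * l)%N by lia.
    rewrite yl xl prednK // -/S => e.
    rewrite mulrCA mulrBr e.
    rewrite !(@big_nat_recr _ _ _ u.+1) //= !(@big_nat_recr _ _ _ u) //=.
    by rewrite !(@big_geq _ _ _ 1 1) //; ring.
  rewrite addnS [kernel _ _ _.+2]/= -/(kernel x y (u.+1 * l + c).+1).
  rewrite px ?(ltnW cl) // xS // yS //.
  rewrite mulrCA mulrBr IHc ?(ltnW cl) //.
  by rewrite !(@big_nat_recr _ _ _ c.+1) //=; ring.
elim: c cl => [_|c IHc cl].
  rewrite mul0n add0n /= -[y 0%N]/(y (0 * l)%N) yl x0 !big_nat1 !big_geq //.
  by ring.
rewrite addnS [kernel _ _ _.+2]/= -/(kernel x y (0 * l + c).+1).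
rewrite px ?(ltnW cl) // xS // yS //.
rewrite mulrCA mulrBr IHc ?(ltnW cl) //.
by rewrite !(@big_nat_recr _ _ _ c.+1) //=; ring.
Qed.

(** * Order of vanishing of polynomials *)

Section Order.
Variables (K : fieldType) (N : nat).
Implicit Types p q c : {mpoly K[N]}.

(** For fixed d these polynomials form an ideal; congruence modulo [vanishes n.+1] replaces
    truncation at degree n. *)
Definition vanishes (d : nat) p := forall m : 'X_{1..N}, (mdeg m < d)%N -> p@_m = 0.

Lemma vanishes0 d : vanishes d 0.
Proof. by move=> m _; rewrite mcoeff0. Qed.

Lemma vanishesD d p q : vanishes d p -> vanishes d q -> vanishes d (p + q).
Proof. by move=> hp hq m hm; rewrite mcoeffD hp ?hq ?addr0. Qed.

Lemma vanishesM a b p q : vanishes a p -> vanishes b q -> vanishes (a + b) (p * q).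
Proof.
move=> hp hq m hm; rewrite mcoeffM big1 // => k /eqP e.
have hk : (mdeg k.1 + mdeg k.2 < a + b)%N by rewrite -mdegD -e.
have [ha|ha] := ltnP (mdeg k.1) a.
  by rewrite hp ?mul0r.
by rewrite hq ?mulr0 // -(ltn_add2l a) (leq_ltn_trans _ hk) // leq_add2r.
Qed.

Lemma vanishesMl d c p : vanishes d p -> vanishes d (c * p).
Proof. by move=> hp; apply: (@vanishesM 0 d). Qed.

Lemma vanishes_sum (I : eqType) (s : seq I) (P : pred I) (F : I -> {mpoly K[N]}) d :
  (forall i, i \in s -> P i -> vanishes d (F i)) ->
  vanishes d (\sum_(i <- s | P i) F i).
Proof.
move=> h; rewrite big_seq_cond; elim/big_ind: _ => [|p q|i /andP[]]; last exact: h.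
  exact: vanishes0.
exact: vanishesD.
Qed.

(** In p = p c + (1 - c) p the last term has order one more than p, so the order of p can be raised
    one by one up to d. *)
Lemma vanishes_cancel d p c : vanishes 1 (1 - c) -> vanishes d (p * c) -> vanishes d p.
Proof.
move=> hc hp; suff h e : (e <= d)%N -> vanishes e p by apply: (h d).
elim: e => [//|e IH] ed.
have -> : p = p * c + (1 - c) * p by ring.
apply: vanishesD; first by move=> m hm; apply: hp; lia.
by apply: (@vanishesM 1 e) => //; apply/IH/ltnW.
Qed.

Lemma unipotentM c c' : vanishes 1 (1 - c) -> vanishes 1 (1 - c') ->
  vanishes 1 (1 - c * c').
Proof.
move=> h h'; have -> : 1 - c * c' = (1 - c) + c * (1 - c') by ring.
by apply: vanishesD => //; apply: vanishesMl.
Qed.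

Lemma unipotent_prod (I : Type) (s : seq I) (P : pred I) (F : I -> {mpoly K[N]}) :
  (forall i, P i -> vanishes 1 (1 - F i)) ->
  vanishes 1 (1 - \prod_(i <- s | P i) F i).
Proof.
move=> h; elim/big_ind: _ => [|p q|//]; last exact: unipotentM.
by rewrite subrr; apply: vanishes0.
Qed.
End Order.

(** * Decreases and records under prepending a letter *)

Lemma is_decrease_cons a w i : is_decrease (a :: w) i.+1 = is_decrease w i.
Proof.
case: w => [|b w]; first by rewrite /is_decrease.
rewrite /is_decrease [(size (a :: b :: w)).-1]/= [(size (b :: w)).-1]/=.
rewrite -[iota 0 (size w).+1]/(0 :: iota (1 + 0) (size w))%N iotaDl /= has_map.
by apply: eq_has => j /=; rewrite subSS ltnS -add1n iotaDl all_map.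
Qed.

(** Either the run of equal letters at the head ends at once with a drop, or it continues in the
    tail and its drop is found there. *)
Lemma is_decrease_head a b w :
  is_decrease [:: a, b & w] 0 = (b < a)%N || (b == a) && is_decrease (b :: w) 0.
Proof.
rewrite {1}/is_decrease [(size _).-1]/=.
rewrite -[iota 0 (size w).+1]/(0 :: iota (1 + 0) (size w))%N iotaDl /= has_map.
rewrite /letter /= eqxx /=; congr (_ || _).
rewrite /is_decrease /=; case: eqP => [->|ne] /=; last first.
  by apply/hasP => -[j _ /=]; case: eqP.
by apply: eq_has => j /=; rewrite subn0 ?eqxx /= add0n -[2%N]/(1 + 1)%N iotaDl all_map.
Qed.

Lemma is_record_cons a w i :
  is_record (a :: w) i.+1 = (a <= letter w i)%N && is_record w i.
Proof.
rewrite /is_record -[iota 0 i.+1]/(0 :: iota (1 + 0) i)%N iotaDl /=.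
by rewrite /letter /= all_map.
Qed.

Lemma wordsS r k :
  words r k.+1 = [seq a :: v | a <- iota 0 r.+1, v <- words r k].
Proof. by []. Qed.

Lemma big_wordsS (R : nmodType) r k (F : seq nat -> R) :
  \sum_(w <- words r k.+1) F w =
  \sum_(0 <= a < r.+1) \sum_(v <- words r k) F (a :: v).
Proof. by rewrite wordsS big_allpairs_dep /index_iota subn0. Qed.

Lemma size_words r k w : w \in words r k -> size w = k.
Proof.
elim: k w => [|k IH] w; first by rewrite inE => /eqP ->.
by rewrite wordsS => /allpairsPdep[a [v [_ hv ->]]] /=; rewrite (IH v).
Qed.

(* [M] is the running maximum of the letters read so far. *)
Fixpoint word_weight (A : comNzRingType) (x y z : nat -> A) (M : nat) (w : seq nat) : A :=
  if w is a :: v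
  then (if is_decrease w 0 then x a else if (M <= a)%N then z a else y a)
       * word_weight x y z (maxn M a) v
  else 1.

(** * Word sums of bounded length satisfy the recursion *)

Section WordSum.
Variables (K : fieldType) (N r n : nat) (x y z : nat -> {mpoly K[N]}).
Hypothesis hx : forall a, vanishes 1 (x a).
Hypothesis hy : forall a, vanishes 1 (y a).
Hypothesis hz : forall a, vanishes 1 (z a).
Let f := word_weight x y z.
Let w M a := if (M <= a)%N then z a else y a.

Let vanishes_word M v : vanishes (size v) (f M v).
Proof.
elim: v M => [|a v IH] M //=; apply: (@vanishesM _ _ 1); last exact: IH.
by do 2?case: ifP.
Qed.

(** Here k is the length of the tail. For a <= M the letter a leaves the state unchanged, so the
    tails in [dk] and [ik] are read in state M. *)
Let gk k M a := \sum_(v <- words r k) f M (a :: v).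
Let dk k M a := \sum_(v <- words r k | is_decrease (a :: v) 0) f M v.
Let ik k M a := \sum_(v <- words r k | ~~ is_decrease (a :: v) 0) f M v.

Let gk_split k M a : (a <= M)%N -> gk k M a = x a * dk k M a + w M a * ik k M a.
Proof.
move=> aM; rewrite /gk (bigID (fun v => is_decrease (a :: v) 0)) /=.
rewrite /dk /ik !mulr_sumr; congr (_ + _); apply: eq_bigr => v.
  by rewrite /f /= (maxn_idPl aM) => ->.
by rewrite /f /= (maxn_idPl aM) => /negPf ->.
Qed.

Let split_at (F : nat -> {mpoly K[N]}) a : (a < r.+1)%N ->
  \sum_(0 <= b < r.+1) F b =
  \sum_(0 <= b < a) F b + F a + \sum_(a.+1 <= b < r.+1) F b.
Proof. by move=> ar; rewrite (@big_cat_nat _ _ _ a) ?(ltnW ar) //= (big_ltn ar) addrA. Qed.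

Let dkS k M a : (a <= M)%N -> (a < r.+1)%N ->
  dk k.+1 M a = \sum_(0 <= b < a) gk k M b + x a * dk k M a.
Proof.
move=> aM ar; rewrite /dk big_mkcond big_wordsS (split_at _ ar) /=.
rewrite [X in _ + X]big_nat_cond [X in _ + X]big1 ?addr0; last first.
  move=> b /andP[/andP[ab _] _]; rewrite big1 // => v _.
  by rewrite is_decrease_head ltnNge (ltnW ab) gtn_eqF.
congr (_ + _).
  apply: eq_big_nat => b /andP[_ ba]; apply: eq_bigr => v _.
  by rewrite is_decrease_head ba.
rewrite mulr_sumr [RHS]big_mkcond /=; apply: eq_bigr => v _.
rewrite is_decrease_head ltnn eqxx /f /= (maxn_idPl aM).
by case: (is_decrease (a :: v) 0).
Qed.

Let ikS k M a : (a <= M)%N -> (a < r.+1)%N ->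
  ik k.+1 M a = w M a * ik k M a + \sum_(a.+1 <= b < r.+1) gk k M b.
Proof.
move=> aM ar; rewrite /ik big_mkcond big_wordsS (split_at _ ar) /=.
rewrite [X in X + _ + _]big_nat_cond [X in X + _ + _]big1 ?add0r; last first.
  move=> b /andP[/andP[_ ba] _]; rewrite big1 // => v _.
  by rewrite is_decrease_head ba.
congr (_ + _); last first.
  apply: eq_big_nat => b /andP[ab _]; apply: eq_bigr => v _.
  by rewrite is_decrease_head ltnNge (ltnW ab) gtn_eqF.
rewrite mulr_sumr [RHS]big_mkcond /=; apply: eq_bigr => v _.
rewrite is_decrease_head ltnn eqxx /f /= (maxn_idPl aM).
by case: (is_decrease (a :: v) 0).
Qed.

(** [g] collects words of length at most n, but [gd] and [gi] tails of length up to n. The excess is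
    a letter weight times tails of length n, hence of order n+1. *)
Let g M a := \sum_(0 <= k < n) gk k M a.
Let gd M a := \sum_(0 <= k < n.+1) dk k M a.
Let gi M a := \sum_(0 <= k < n.+1) ik k M a.

Let hw M a : vanishes 1 (w M a).
Proof. by rewrite /w; case: ifP. Qed.

Let vanishes_dk M a : vanishes n (dk n M a).
Proof. by apply: vanishes_sum => v hv _; rewrite -(size_words hv). Qed.

Let vanishes_ik M a : vanishes n (ik n M a).
Proof. by apply: vanishes_sum => v hv _; rewrite -(size_words hv). Qed.

Lemma word_sum_congr :
  vanishes n.+1
   ((\sum_(0 <= k < n.+1) \sum_(v <- words r k) f 0 v) * kernel x y r.+1
     * \prod_(0 <= i < r.+1) (1 - z i)
    - \prod_(0 <= i < r.+1) (1 - x i) * \prod_(0 <= i < r.+1) (1 - y i)).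
Proof.
have -> : \sum_(0 <= k < n.+1) \sum_(v <- words r k) f 0 v
          = 1 + \sum_(0 <= b < r.+1) g 0 b.
  rewrite big_nat_recl // big_seq1 exchange_big /=; congr (_ + _).
  by apply: eq_bigr => k _; rewrite big_wordsS.
apply: (@word_sum_kernel _ (vanishes n.+1) _ _ _ _ x y z g gd gi).
- exact: vanishes0.
- exact: vanishesD.
- by move=> c a; apply: vanishesMl.
- move=> M a aM aL; rewrite /g (eq_bigr (fun k => x a * dk k M a + w M a * ik k M a)).
    rewrite big_split /= -!mulr_sumr /gd /gi !(@big_nat_recr _ _ _ n) //=.
    rewrite -/(w M a).
    set D := \sum_(_ <= _ < _) dk _ _ _; set I := \sum_(_ <= _ < _) ik _ _ _.
    have -> : x a * D + w M a * I - (x a * (D + dk n M a) + w M a * (I + ik n M a))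
       = x a * ((-1) * dk n M a) + w M a * ((-1) * ik n M a) by ring.
    by apply: vanishesD; apply: (@vanishesM _ _ 1) => //; apply: vanishesMl.
  by move=> k _; apply: gk_split.
- move=> M a aM aL; rewrite mulrBl mul1r {1}/gd big_nat_recl //=.
  (* A letter with empty tail is an increase; the same fact gives the summand 1 for [ik] below. *)
  have -> : dk 0 M a = 0 by rewrite /dk big_mkcond big_seq1.
  rewrite add0r.
  rewrite (eq_bigr (fun k => \sum_(0 <= b < a) gk k M b + x a * dk k M a)); last first.
    by move=> k _; apply: dkS.
  rewrite big_split /= exchange_big -/(g M) -mulr_sumr /gd (@big_nat_recr _ _ _ n 0) //=.
  set D := \sum_(_ <= _ < n) dk _ _ _; set G := \sum_(_ <= _ < a) _.
  have -> : G + x a * D - x a * (D + dk n M a) - G = x a * ((-1) * dk n M a) by ring.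
  by apply: (@vanishesM _ _ 1) => //; apply: vanishesMl.
- move=> M a aM aL; rewrite mulrBl mul1r {1}/gi big_nat_recl //=.
  have -> : ik 0 M a = 1 by rewrite /ik big_mkcond big_seq1.
  rewrite (eq_bigr (fun k => w M a * ik k M a + \sum_(a.+1 <= b < r.+1) gk k M b)); last first.
    by move=> k _; apply: ikS.
  rewrite big_split /= [X in _ + (_ + X)]exchange_big -/(g M) -mulr_sumr /gi.
  rewrite (@big_nat_recr _ _ _ n 0) //=.
  rewrite -/(w M a).
  set D := \sum_(_ <= _ < n) ik _ _ _; set G := \sum_(_ <= _ < r.+1) _.
  have -> : 1 + (w M a * D + G) - w M a * (D + ik n M a) - (1 + G)
    = w M a * ((-1) * ik n M a) by ring.
  by apply: (@vanishesM _ _ 1) => //; apply: vanishesMl.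
(* A first letter a >= M that increases is a record in state M as in state a, and both states
   continue with maximum a. *)
- move=> M a Ma; rewrite /g; apply: eq_bigr => k _; apply: eq_bigr => v _ /=.
  by rewrite /f /= Ma leqnn maxnn (maxn_idPr Ma).
(* By induction on a, the factor k_a - x_a p_a has constant term 1. *)
- move=> a c; apply: vanishes_cancel; elim: a => [|a IH] /=.
    by rewrite big_nil mulr1; have -> : 1 - (1 - x 0) = x 0 by ring.
  set k := kernel x y a - _ in IH *; have hk : vanishes 1 (1 - (1 - y a) * k).
    apply: unipotentM => //.
    by have -> : 1 - (1 - y a) = y a by ring.
  set p := \prod_(_ <= _ < _) _.
  have -> : 1 - ((1 - y a) * k - x a.+1 * p) = (1 - (1 - y a) * k) + p * x a.+1 by ring.
  by apply: vanishesD => //; apply: vanishesMl.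
Qed.
End WordSum.

(** * Series represented by polynomials *)

Section Represent.
Variables (K : fieldType) (N : nat).
Implicit Types (s : seq nat) (p q : {mpoly K[N]}).

Definition mnm_of_seq s : 'X_{1..N} := [multinom count_mem (val i) s | i < N].

Lemma mnm_of_seq_cons (i : 'I_N) s : mnm_of_seq (val i :: s) = (U_(i) + mnm_of_seq s)%MM.
Proof. by apply/mnmP => j; rewrite mnmDE mnm1E !mnmE. Qed.

Lemma mnm_of_seq_nil : mnm_of_seq [::] = 0%MM.
Proof. by apply/mnmP => j; rewrite !mnmE. Qed.

Lemma mdeg_mnm_of_seq s : all (gtn N) s -> mdeg (mnm_of_seq s) = size s.
Proof.
elim: s => [_|a s IH /= /andP[aN sN]]; first by rewrite mnm_of_seq_nil mdeg0.
by rewrite -[a]/(val (Ordinal aN)) mnm_of_seq_cons mdegD mdeg1 IH.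
Qed.

Lemma mnm_of_seq_perm s s' : all (gtn N) s -> all (gtn N) s' ->
  (mnm_of_seq s == mnm_of_seq s') = perm_eq s s'.
Proof.
move=> sN sN'; apply/eqP/idP => [e|/permP e]; last by apply/mnmP => i; rewrite !mnmE.
apply/allP => a; rewrite mem_cat => ha.
have aN : (a < N)%N by case/orP: ha; [move/(allP sN)|move/(allP sN')].
by move/mnmP/(_ (Ordinal aN)): e; rewrite !mnmE => /= ->.
Qed.

Lemma mem_bits k b : (b \in bits k) = (size b == k).
Proof.
elim: k b => [|k IH] b; first by rewrite inE size_eq0.
rewrite mem_cat; case: b => [|c b].
  by apply/negbTE/norP; split; apply/mapP => -[].
rewrite eqSS -IH; apply/orP/idP => [|hb].
  by case=> /mapP [b' hb' [_ ->]].
by case: c; [left|right]; apply: map_f.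
Qed.

Lemma splitsP s u : reflect
  (exists2 b, size b = size s & u = (mask b s, mask (map negb b) s)) (u \in splits s).
Proof.
rewrite mem_undup; apply: (iffP mapP) => [[b]|[b hb ->]].
  by rewrite mem_bits => /eqP hb ->; exists b.
by exists b => //; rewrite mem_bits hb.
Qed.

Lemma mnm_of_seq_mask b s : size b = size s ->
  (mnm_of_seq (mask b s) + mnm_of_seq (mask (map negb b) s))%MM = mnm_of_seq s.
Proof.
move=> hb; apply/mnmP => i; rewrite mnmDE !mnmE.
elim: b s hb => [|[] b IH] [|a s] //= [/IH <-]; [by rewrite addnA | exact: addnCA].
Qed.

(** Distribute the entries of s one at a time: each goes to k1 while k1 still contains it, and
    otherwise to k2, which then must contain it. *)
Lemma mnm_of_seq_split s (k1 k2 : 'X_{1..N}) : all (gtn N) s ->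
  mnm_of_seq s = (k1 + k2)%MM ->
  exists2 b, size b = size s &
    mnm_of_seq (mask b s) = k1 /\ mnm_of_seq (mask (map negb b) s) = k2.
Proof.
elim: s k1 k2 => [|a s IH] k1 k2 /=.
  move=> _ e; exists [::] => //=.
  have /andP[/eqP -> /eqP ->] : (k1 == 0%MM) && (k2 == 0%MM).
    by rewrite -mnmD_eq0 -e mnm_of_seq_nil.
  by rewrite mnm_of_seq_nil.
case/andP=> aN sN; set i := Ordinal aN; rewrite -[a]/(val i) mnm_of_seq_cons => e.
have h (k k' : 'X_{1..N}) : (0 < k i)%N -> (U_(i) + mnm_of_seq s = k + k')%MM ->
    exists2 k'', k = (U_(i) + k'')%MM & mnm_of_seq s = (k'' + k')%MM.
  move=> ki ek; have hk : k = (U_(i) + (k - U_(i)))%MM.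
    by apply/mnmP => j; rewrite mnmDE mnmBE mnm1E; case: eqP => [<-|_]; lia.
  exists (k - U_(i))%MM => //; apply/mnmP => j.
  by move/mnmP/(_ j): ek; rewrite {1}hk !mnmDE -addnA => /addnI.
case: (posnP (k1 i)) => [k1i|/h/(_ e)[k -> /(IH _ _ sN)[b hb [<- <-]]]]; last first.
  by exists (true :: b); rewrite /= ?hb // -mnm_of_seq_cons.
have k2i : (0 < k2 i)%N.
  by move/mnmP/(_ i): e; rewrite !mnmDE mnm1E eqxx k1i add0n => <-.
have [k -> ] := h _ _ k2i (etrans e (addmC _ _)).
rewrite addmC => /(IH _ _ sN)[b hb [<- <-]].
by exists (false :: b); rewrite /= ?hb // -mnm_of_seq_cons.
Qed.

Variable n : nat.

(** Nothing is required in degree above n, so p matters only modulo [vanishes n.+1]. *)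
Definition represents p (F : series K) := forall s,
  sorted leq s -> all (gtn N) s -> (size s <= n)%N -> p@_(mnm_of_seq s) = F s.

(** Both products sum over the factorisations of the monomial s. [splits] lists each once: it has no
    duplicates, and a sorted sublist is determined by its exponents. *)
Lemma representsM p q F G :
  represents p F -> represents q G -> represents (p * q) (smul F G).
Proof.
move=> hp hq s srt sN sn; rewrite mcoeffM /smul.
transitivity (\sum_(u <- [seq (mnm_of_seq u.1, mnm_of_seq u.2) | u <- splits s])
    p@_u.1 * q@_u.2); last first.
  rewrite big_map; apply: eq_big_seq => u /splitsP[b hb ->] /=.
  have hm c : sorted leq (mask c s) /\ all (gtn N) (mask c s) /\ (size (mask c s) <= n)%N.
    split; first exact: (sorted_mask leq_trans).
    split; first by apply/allP => x /mem_mask; apply: (allP sN).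
    exact: leq_trans (size_subseq (mask_subseq _ _)) sn.
  have [? [? ?]] := hm b; have [? [? ?]] := hm (map negb b).
  by rewrite hp ?hq.
rewrite -big_enum /=.
rewrite -(big_map (fun k : 'X_{1..N < _, _} => (bmnm k.1, bmnm k.2)) xpredT
  (fun u => p@_u.1 * q@_u.2)).
apply/perm_big/uniq_perm.
- rewrite map_inj_in_uniq ?enum_uniq // => -[k1 k2] [k1' k2'] _ _ /= [e1 e2].
  by congr (_, _); apply/val_inj.
- rewrite map_inj_in_uniq ?undup_uniq // => u u' /splitsP[b hb ->] /splitsP[b' hb' ->].
  move=> e; have e1 := congr1 fst e; have e2 := congr1 snd e.
  have hm c c' : mnm_of_seq (mask c s) = mnm_of_seq (mask c' s) -> mask c s = mask c' s.
    move/eqP; rewrite mnm_of_seq_perm; last 2 first.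
    - by apply/allP => x /mem_mask; apply: (allP sN).
    - by apply/allP => x /mem_mask; apply: (allP sN).
    by apply: (sorted_eq leq_trans anti_leq); apply: (sorted_mask leq_trans).
  by rewrite (hm _ _ e1) (hm _ _ e2).
move=> [k1 k2]; apply/mapP/mapP => [[k]|[u /splitsP[b hb ->]] /= [-> ->]].
  rewrite mem_enum => hk [-> ->].
  have e : mnm_of_seq s = (k.1 + k.2)%MM by apply/eqP.
  have [b hb [<- <-]] := mnm_of_seq_split sN e.
  by exists (mask b s, mask (map negb b) s) => //; apply/splitsP; exists b.
have e := mnm_of_seq_mask hb.
set m1 := mnm_of_seq _ in e *; set m2 := mnm_of_seq _ in e *.
have h1 : (mdeg m1 < (mdeg (mnm_of_seq s)).+1)%N by rewrite -e mdegD ltnS leq_addr.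
have h2 : (mdeg m2 < (mdeg (mnm_of_seq s)).+1)%N by rewrite -e mdegD ltnS leq_addl.
exists (BMultinom h1, BMultinom h2) => //.
by rewrite mem_enum; apply: (introT (@eqP 'X_{1..N} _ _) (esym e)).
Qed.

Lemma representsC c : represents c%:MP (sconst c).
Proof.
move=> s _ sN _; rewrite mcoeffC -mdeg_eq0 mdeg_mnm_of_seq //.
by case: s {sN} => [|a s]; rewrite /= ?mulr1 ?mulr0.
Qed.

Lemma representsD p q F G :
  represents p F -> represents q G -> represents (p + q) (sadd F G).
Proof. by move=> hp hq s *; rewrite mcoeffD hp ?hq. Qed.

Lemma representsN p F : represents p F -> represents (- p) (sopp F).
Proof. by move=> hp s *; rewrite mcoeffN hp. Qed.

Lemma representsZ c p F : represents p F -> represents (c%:MP * p) (sscale c F).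
Proof. by move=> hp s *; rewrite mcoeffCM hp. Qed.

Lemma represents_sprod (I : Type) (r : seq I) (P : I -> {mpoly K[N]}) (F : I -> series K) :
  (forall i, represents (P i) (F i)) ->
  represents (\prod_(i <- r) P i) (sprod [seq F i | i <- r]).
Proof.
move=> h; elim: r => [|i r IH]; first by rewrite big_nil; apply: representsC.
by rewrite big_cons; apply: representsM.
Qed.

Lemma represents_congr p q F G s : represents p F -> represents q G ->
  vanishes n.+1 (p - q) -> sorted leq s -> all (gtn N) s -> (size s <= n)%N ->
  F s = G s.
Proof.
move=> hp hq hpq srt sN sn; rewrite -hp // -hq //; apply/eqP.
by rewrite -subr_eq0 -mcoeffB hpq // mdeg_mnm_of_seq.
Qed.

(** * The series H and E in finitely many variables *)

(* Variables beyond the first N are set to 0. *)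
Definition Yvar (u : nat) : {mpoly K[N]} := if insub u is Some i then 'X_i else 0.

Lemma Yvar_ord (i : 'I_N) : Yvar i = 'X_i.
Proof. by rewrite /Yvar valK. Qed.

Lemma Yvar_geq u : (N <= u)%N -> Yvar u = 0.
Proof. by move=> h; rewrite /Yvar insubF // ltnNge h. Qed.

Lemma vanishes_Yvar u : vanishes 1 (Yvar u).
Proof.
move=> m; rewrite ltnS leqn0 mdeg_eq0 => /eqP ->; rewrite /Yvar.
by case: insub => [i|]; rewrite ?mcoeff0 // mcoeffX mnm1_eq0.
Qed.

Lemma mcoeffMXi p (i : 'I_N) (k : 'X_{1..N}) :
  (p * 'X_i)@_k = if (0 < k i)%N then p@_(k - U_(i)) else 0.
Proof.
case: ifP => ki.
  suff {1}-> : k = (U_(i) + (k - U_(i)))%MM by rewrite mcoeffMX.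
  by apply/mnmP => j; rewrite mnmDE mnmBE mnm1E; case: eqP => [<-|_]; lia.
rewrite mcoeffM big1 // => u /eqP e; rewrite mcoeffX; case: eqP => e2; last by rewrite mulr0.
have : k i = (u.1 i + u.2 i)%N by rewrite -mnmDE -e.
by move=> ei; move: ki; rewrite ei -e2 mnm1E eqxx addn1.
Qed.

Lemma mdeg_subU (i : 'I_N) (k : 'X_{1..N}) : (0 < k i)%N -> mdeg k = (mdeg (k - U_(i))%MM).+1.
Proof.
move=> ki; rewrite -addn1 -(mdeg1 i) -mdegD; congr (mdeg _).
by apply/mnmP => j; rewrite mnmDE mnmBE mnm1E; case: eqP => [<-|_]; lia.
Qed.

(* H(a Y) without the variables Y_0, ..., Y_{i-1}, truncated at degree n:
   multiplying by 1 - a Y_i removes one more variable. *)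
Definition hpoly (a : K) (i : nat) : {mpoly K[N]} :=
  \sum_(k : 'X_{1..N < n.+1})
    (a ^+ mdeg k * [forall j : 'I_N, (j < i)%N ==> (k j == 0%N)]%:R) *: 'X_[k].

Lemma mcoeff_hpoly a i (k : 'X_{1..N}) : (mdeg k < n.+1)%N ->
  (hpoly a i)@_k = a ^+ mdeg k * [forall j : 'I_N, (j < i)%N ==> (k j == 0%N)]%:R.
Proof.
move=> hk; rewrite /hpoly (mcoeff_mpoly (fun k => a ^+ mdeg k *
  [forall j : 'I_N, (j < i)%N ==> (k j == 0%N)]%:R)) //.
Qed.

(** On a monomial divisible by Y_i, the coefficient of [hpoly a i] is a times that of the monomial
    divided by Y_i, so the two contributions cancel; the other monomials are untouched. *)
Lemma hpolyS a (i : 'I_N) :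
  vanishes n.+1 ((1 - a%:MP * Yvar i) * hpoly a i - hpoly a i.+1).
Proof.
move=> k hk; rewrite mulrBl mul1r -mulrA [_ * hpoly _ _]mulrC Yvar_ord !mcoeffB mcoeffCM.
rewrite mcoeffMXi !(mcoeff_hpoly _ _ hk).
have step : [forall j : 'I_N, (j < i.+1)%N ==> (k j == 0%N)] =
    (k i == 0%N) && [forall j : 'I_N, (j < i)%N ==> (k j == 0%N)].
  apply/forallP/andP => [h|[/eqP h0 /forallP h] j].
    split; first by have := h i; rewrite leqnn.
    by apply/forallP => j; apply/implyP => /ltnW ji; have := h j; rewrite ltnS ji.
  rewrite ltnS leq_eqVlt; apply/implyP => /orP[/eqP/val_inj->|ji]; first exact/eqP.
  by have := h j; rewrite ji.
rewrite step; case: (posnP (k i)) => [_|ki] /=; first by rewrite mulr0 subr0 subrr.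
rewrite mulr0 subr0 mcoeff_hpoly; last by rewrite ltnS ltnW // -mdeg_subU.
rewrite (mdeg_subU ki) exprS -mulrA; apply/eqP; rewrite subr_eq0; apply/eqP.
do 2 congr (_ * _); congr (nat_of_bool _)%:R; apply: eq_forallb => j.
by case: ltnP => //= ji; rewrite mnmBE mnm1E -(inj_eq val_inj) (gtn_eqF ji) subn0.
Qed.

Lemma hpoly_inv a : vanishes n.+1 (\prod_(0 <= v < N) (1 - a%:MP * Yvar v) * hpoly a 0 - 1).
Proof.
have h i : (i <= N)%N ->
    vanishes n.+1 (\prod_(0 <= v < i) (1 - a%:MP * Yvar v) * hpoly a 0 - hpoly a i).
  elim: i => [|i IH] iN; first by rewrite big_nil mul1r subrr; apply: vanishes0.
  rewrite big_nat_recr //=; set P := \prod_(_ <= _ < _) _; set y := Yvar i.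
  have -> : P * (1 - a%:MP * y) * hpoly a 0 - hpoly a i.+1 =
    (1 - a%:MP * y) * (P * hpoly a 0 - hpoly a i)
    + ((1 - a%:MP * y) * hpoly a i - hpoly a i.+1) by ring.
  apply: vanishesD; first by apply/vanishesMl/IH/ltnW.
  exact: (hpolyS a (Ordinal iN)).
(* Once all N variables are removed, only the constant term is left. *)
have e : vanishes n.+1 (hpoly a N - 1).
  move=> k hk; rewrite mcoeffB mcoeff1 mcoeff_hpoly //.
  have -> : [forall j : 'I_N, (j < N)%N ==> (k j == 0%N)] = (k == 0%MM).
    apply/forallP/eqP => [h0|-> j]; last by rewrite mnm0E eqxx implybT.
    by apply/mnmP => j; have := h0 j; rewrite ltn_ord mnm0E => /eqP.
  by case: eqP => [->|_]; rewrite ?mdeg0 ?expr0 ?mulr1 ?mulr0 subrr.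
have := vanishesD (h N (leqnn N)) e; congr (vanishes _ _); ring.
Qed.

Lemma represents_hpoly a : represents (hpoly a 0) (Hser a).
Proof.
move=> s _ sN sn; rewrite mcoeff_hpoly mdeg_mnm_of_seq //.
by rewrite (_ : [forall j, _]) ?mulr1 //; apply/forallP.
Qed.

(** The boolean [j < i], read as a number, bounds the exponent of Y_j: 1 for the variables already
    multiplied in, 0 for the others. *)
Lemma mcoeff_epoly a i (k : 'X_{1..N}) : (i <= N)%N ->
  (\prod_(0 <= v < i) (1 + a%:MP * Yvar v))@_k =
  a ^+ mdeg k * [forall j : 'I_N, k j <= (j < i)]%N%:R.
Proof.
elim: i k => [|i IH] k iN.
  rewrite big_nil mcoeff1.
  have -> : [forall j : 'I_N, k j <= (j < 0)]%N = (k == 0%MM).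
    apply/forallP/eqP => [h0|-> j]; last by rewrite mnm0E.
    by apply/mnmP => j; have := h0 j; rewrite ltn0 leqn0 mnm0E => /eqP.
  by case: eqP => [->|_]; rewrite ?mdeg0 ?expr0 ?mulr1 ?mulr0.
set o := Ordinal iN.
have ltS (j : 'I_N) : (j < i.+1)%N = (j == o) || (j < i)%N by rewrite ltnS leq_eqVlt.
rewrite big_nat_recr //= mulrDr mulr1 mulrCA mcoeffD mcoeffCM -[i in Yvar i]/(val o).
rewrite Yvar_ord mcoeffMXi !IH ?(ltnW iN) //.
(* Passing from i to i+1 changes only the bound at [o]; [step], [old] and [same] separate that index
   from the others. *)
have step : [forall j : 'I_N, k j <= (j < i.+1)]%N =
    (k o <= 1)%N && [forall j : 'I_N, (j != o) ==> (k j <= (j < i))%N].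
  apply/forallP/andP => [h|[h0 /forallP h] j].
    split; first by have := h o; rewrite ltS eqxx.
    apply/forallP => j; apply/implyP => ji; have := h j.
    by rewrite ltS (negbTE ji).
  by rewrite ltS; case: eqVneq => [->//|jo]; have := h j; rewrite jo.
have old (k' : 'X_{1..N}) : [forall j : 'I_N, k' j <= (j < i)]%N =
    (k' o == 0)%N && [forall j : 'I_N, (j != o) ==> (k' j <= (j < i))%N].
  apply/forallP/andP => [h|[/eqP h0 /forallP h] j].
    split; first by have := h o; rewrite /= ltnn leqn0.
    by apply/forallP => j; rewrite h implybT.
  by case: (eqVneq j o) => [->|jo]; [rewrite h0 | have := h j; rewrite jo].
have same : [forall j : 'I_N, (j != o) ==> ((k - U_(o))%MM j <= (j < i))%N] =
    [forall j : 'I_N, (j != o) ==> (k j <= (j < i))%N].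
  apply: eq_forallb => j; rewrite mnmBE mnm1E eq_sym.
  by case: eqP => //= _; rewrite subn0.
rewrite step old; case: (posnP (k o)) => [->|ko] /=; first by rewrite mulr0 addr0.
rewrite mulr0 add0r old same mnmBE mnm1E eqxx subn_eq0.
by rewrite (mdeg_subU ko) exprS mulrA.
Qed.

Lemma uniq_count_le1 s : uniq s = all (fun x => count_mem x s <= 1)%N s.
Proof.
apply/idP/allP => [us x xs|]; first by rewrite count_uniq_mem // leq_b1.
elim: s => //= a s IH h; rewrite -has_pred1 has_count -leqNgt.
have := h a (mem_head _ _); rewrite eqxx add1n ltnS leqn0 => /eqP ->; rewrite /= IH // => x xs.
by have := h x (mem_behead (s := a :: s) xs); apply: leq_trans; rewrite leq_addl.
Qed.

Lemma represents_epoly a :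
  represents (\prod_(0 <= v < N) (1 + a%:MP * Yvar v)) (Eser a).
Proof.
move=> s _ sN sn; rewrite mcoeff_epoly // mdeg_mnm_of_seq // /Eser uniq_count_le1.
have -> : [forall j : 'I_N, mnm_of_seq s j <= (j < N)]%N =
    all (fun x => count_mem x s <= 1)%N s.
  apply/forallP/allP => [h x xs|h j]; last first.
    rewrite ltn_ord mnmE; have [js|js] := boolP (val j \in s); first exact: h.
    by rewrite (count_memPn js).
  have xN : (x < N)%N by apply: (allP sN).
  by have := h (Ordinal xN); rewrite ltn_ord mnmE.
by case: all; rewrite ?mulr1 ?mulr0.
Qed.
End Represent.

(** * The quotient formula for the weights of the theorem *)

Section LetterWeights.
Variables (K : fieldType) (N l : nat) (t : K) (rr ss : nat -> K).
Local Notation Y := (Yvar K N).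

(* Letter 0 never decreases, so its decrease weight is set to 0. *)
Definition dec_weight (a : nat) : {mpoly K[N]} :=
  if a == 0%N then 0
  else if (a %% l == 0)%N then t%:MP * Y (a %/ l).-1 else (ss (a %% l)%N)%:MP * Y (a %/ l).
Definition inc_weight (a : nat) : {mpoly K[N]} :=
  if (a %% l == 0)%N then Y (a %/ l) else (ss (a %% l)%N)%:MP * Y (a %/ l).
Definition rec_weight (a : nat) : {mpoly K[N]} :=
  if (a %% l == 0)%N then (rr 0)%:MP * Y (a %/ l)
  else (rr (a %% l)%N * ss (a %% l)%N)%:MP * Y (a %/ l).

Definition word_sum (r n : nat) : {mpoly K[N]} :=
  \sum_(0 <= k < n.+1) \sum_(w <- words r k)
    word_weight dec_weight inc_weight rec_weight 0 w.

Lemma vanishes1_scaleY (c : K) u : vanishes 1 (c%:MP * Y u).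
Proof. by apply/vanishesMl/vanishes_Yvar. Qed.

Lemma vanishes_mul_sub1 n (a b c d : {mpoly K[N]}) :
  vanishes n (a * b - 1) -> vanishes n (c * d - 1) ->
  vanishes n (a * c * (b * d) - 1).
Proof.
move=> h h'.
have -> : a * c * (b * d) - 1 = c * d * (a * b - 1) + 1 * (c * d - 1) by ring.
by apply: vanishesD; apply: vanishesMl.
Qed.

Hypothesis l0 : (0 < l)%N.

Lemma block_mod u m : (m < l)%N -> ((u * l + m) %% l = m)%N.
Proof. by move=> ml; rewrite modnMDl modn_small. Qed.

Lemma block_div u m : (m < l)%N -> ((u * l + m) %/ l = u)%N.
Proof. by move=> ml; rewrite divnMDl // divn_small // addn0. Qed.

Lemma dec_weight_residue u m : (0 < m < l)%N -> dec_weight (u * l + m) = (ss m)%:MP * Y u.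
Proof.
case/andP=> m0 ml; rewrite /dec_weight block_mod // block_div //.
by rewrite addn_eq0 (gtn_eqF m0) andbF.
Qed.

Lemma dec_weight_block u : dec_weight (u.+1 * l) = t%:MP * Y u.
Proof. by rewrite /dec_weight muln_eq0 (gtn_eqF l0) modnMl mulnK. Qed.

Lemma inc_weight_residue u m : (0 < m < l)%N -> inc_weight (u * l + m) = (ss m)%:MP * Y u.
Proof.
by case/andP=> m0 ml; rewrite /inc_weight block_mod // block_div // gtn_eqF.
Qed.

Lemma inc_weight_block u : inc_weight (u * l) = Y u.
Proof. by rewrite /inc_weight modnMl mulnK. Qed.

Lemma rec_weight_residue u m : (0 < m < l)%N ->
  rec_weight (u * l + m) = (rr m * ss m)%:MP * Y u.
Proof.
by case/andP=> m0 ml; rewrite /rec_weight block_mod // block_div // gtn_eqF.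
Qed.

Lemma rec_weight_block u : rec_weight (u * l) = (rr 0)%:MP * Y u.
Proof. by rewrite /rec_weight modnMl mulnK. Qed.

Let S := \sum_(1 <= m < l) ss m.

(** The largest letter N * l makes all products close up: as a decrease it carries t Y_{N-1}, the
    last factor of prod_{v<N} (1 - t Y_v), while as an increase it carries Y_N = 0. *)
Lemma word_sum_quotient n :
  vanishes n.+1
    (word_sum (N * l) n
       * ((1 + S)%:MP * hpoly N n t 0 - (t + S)%:MP * hpoly N n 1 0)
     - hpoly N n (rr 0) 0 * ((1 - t)%:MP *
       \prod_(m <- iota 1 l.-1)
         (\prod_(0 <= v < N) (1 + (- ss m)%:MP * Y v) * hpoly N n (rr m * ss m) 0))).
Proof.
have := @word_sum_congr K N (N * l) n dec_weight inc_weight rec_weight.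
rewrite -/(word_sum (N * l) n).
set W := word_sum _ _; set k := kernel _ _ _.
have -> : iota 1 l.-1 = index_iota 1 l by rewrite /index_iota subn1.
rewrite big_split /=.
set Sg := \prod_(1 <= m < l) _; set hs := \prod_(1 <= m < l) _ => hW.
pose T := \prod_(0 <= v < N) (1 - t%:MP * Y v).
pose B := \prod_(0 <= v < N) (1 - Y v).
pose R0 := \prod_(0 <= v < N) (1 - (rr 0)%:MP * Y v).
pose Rs := \prod_(1 <= m < l) \prod_(0 <= v < N) (1 - (rr m * ss m)%:MP * Y v).
have YN : Y N = 0 by rewrite Yvar_geq.
have eSg : \prod_(0 <= v < N) \prod_(1 <= m < l) (1 - (ss m)%:MP * Y v) = Sg.
  rewrite exchange_big; apply: eq_bigr => m _; apply: eq_bigr => v _.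
  by rewrite mpolyCN mulNr.
have ex : \prod_(0 <= i < (N * l).+1) (1 - dec_weight i) = T * Sg.
  rewrite -[(N * l)%N]addn0 prod_blocks // [X in _ * X]big_geq // mulr1.
  rewrite big_nat_recl // mul0n {1}/dec_weight eqxx subr0 mul1r -eSg; congr (_ * _).
    by apply: eq_bigr => v _; rewrite dec_weight_block.
  by apply: eq_bigr => v _; apply: eq_big_nat => m hm; rewrite dec_weight_residue.
have ey : \prod_(0 <= i < (N * l).+1) (1 - inc_weight i) = B * Sg.
  rewrite -[(N * l)%N]addn0 prod_blocks // [X in _ * X]big_geq // mulr1.
  rewrite big_nat_recr //= inc_weight_block YN subr0 mulr1 -eSg; congr (_ * _).
    by apply: eq_bigr => v _; rewrite inc_weight_block.
  by apply: eq_bigr => v _; apply: eq_big_nat => m hm; rewrite inc_weight_residue.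
have ez : \prod_(0 <= i < (N * l).+1) (1 - rec_weight i) = R0 * Rs.
  rewrite -[(N * l)%N]addn0 prod_blocks // [X in _ * X]big_geq // mulr1.
  rewrite big_nat_recr //= rec_weight_block YN mulr0 subr0 mulr1; congr (_ * _).
    by apply: eq_bigr => v _; rewrite rec_weight_block.
  rewrite /Rs exchange_big; apply: eq_big_nat => m hm; apply: eq_bigr => v _.
  by rewrite rec_weight_residue.
have ek : (1 - t%:MP) * k = Sg * ((1 + S%:MP) * B - (t%:MP + S%:MP) * T).
  rewrite /k -[(N * l)%N]addn0.
  rewrite (@kernel_blocks _ l t%:MP (fun m => (ss m)%:MP) Y) //.
  - rewrite eSg [X in _ * X * _]big_geq // [\prod_(0 <= v < N.+1) _]big_nat_recr //=.
    by rewrite YN raddf_sum -/T -/B; ring.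
  - exact: dec_weight_block.
  - exact: inc_weight_block.
  - exact: dec_weight_residue.
  - exact: inc_weight_residue.
have hT : vanishes n.+1 (T * hpoly N n t 0 - 1) by apply: hpoly_inv.
have hB : vanishes n.+1 (B * hpoly N n 1 0 - 1).
  have := @hpoly_inv K N n 1; congr (vanishes _ (_ * _ - 1)).
  by apply: eq_bigr => v _; rewrite mul1r.
have hR0 : vanishes n.+1 (R0 * hpoly N n (rr 0) 0 - 1) by apply: hpoly_inv.
have hRs : vanishes n.+1 (Rs * hs - 1).
  rewrite /Rs /hs; elim: (index_iota 1 l) => [|m ms IH].
    by rewrite !big_nil mulr1 subrr; apply: vanishes0.
  by rewrite !big_cons; apply: vanishes_mul_sub1 => //; apply: hpoly_inv.
have hSg : vanishes 1 (1 - Sg).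
  apply: unipotent_prod => m _; apply: unipotent_prod => v _.
  by rewrite opprD addrA subrr add0r -mulN1r; apply/vanishesMl/vanishes1_scaleY.
(* The word sum identity has Sg twice on the right and once inside k. Cancelling one leaves the
   other as the product of the E(-s_m Y). *)
apply: (vanishes_cancel hSg).
move: hW; rewrite ex ey ez => hW.
have {}hW : vanishes n.+1 (W * k * (R0 * Rs) - T * Sg * (B * Sg)).
  by apply: hW => a; rewrite /dec_weight /inc_weight /rec_weight;
     do ?case: ifP => _; rewrite ?mul1r;
     solve [exact: vanishes0 | exact: vanishes1_scaleY | exact: vanishes_Yvar].
rewrite !mpolyCD mpolyCN mpolyC1.
set ht := hpoly _ _ t 0 in hT *; set h1 := hpoly _ _ 1 0 in hB *.
set h0 := hpoly _ _ (rr 0) 0 in hR0 *.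
have hR := vanishes_mul_sub1 hR0 hRs.
have hBR := vanishes_mul_sub1 hB hR; have hTR := vanishes_mul_sub1 hT hR.
have hTB := vanishes_mul_sub1 hT hB.
clearbody k T B R0 Rs Sg hs W ht h1 h0 => {ex ey ez eSg hSg hT hB hR0 hRs hR YN}.
move: t%:MP S%:MP ek => u v ek.
(* Multiply the word sum identity by (1 - t) and by all the H factors; the other three terms correct
   for these being inverses only modulo order n+1. *)
have -> : (W * ((1 + v) * ht - (u + v) * h1) - h0 * ((1 - u) * (Sg * hs))) * Sg =
   ht * h1 * h0 * hs * ((1 - u) * (W * k * (R0 * Rs) - T * Sg * (B * Sg)))
   + (- (W * Sg * (1 + v) * ht) * (B * (R0 * Rs) * (h1 * (h0 * hs)) - 1)
   + (W * Sg * (u + v) * h1 * (T * (R0 * Rs) * (ht * (h0 * hs)) - 1)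
   + (1 - u) * Sg * Sg * h0 * hs * (T * B * (ht * h1) - 1))).
  have -> : (1 - u) * (W * k * (R0 * Rs) - T * Sg * (B * Sg)) =
    W * ((1 - u) * k) * (R0 * Rs) - (1 - u) * (T * Sg * (B * Sg)) by ring.
  by rewrite ek; ring.
apply: vanishesD; first by do 2 apply: vanishesMl.
apply: vanishesD; first exact: vanishesMl.
by apply: vanishesD; apply: vanishesMl.
Qed.
End LetterWeights.

(** * From the original weights to word sums, and the limit *)

(** Makes the value 0 of [dec_weight] at letter 0 harmless. *)
Lemma is_decrease_gt0 w i : is_decrease w i -> (0 < letter w i)%N.
Proof.
case/hasP => j _ /and3P[ij /allP h]; have := h j; rewrite mem_iota ij addnS ltnS subnKC //.
by move=> /(_ (leqnn _)) /eqP ->; case: (letter w i).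
Qed.

(** The state M acts like an earlier letter that a record must also reach; for M = 0 this is no
    constraint. *)
Lemma word_weightE (A : comNzRingType) (x y z : nat -> A) M w :
  word_weight x y z M w = \prod_(0 <= i < size w)
    (if is_decrease w i then x (letter w i)
     else if (M <= letter w i)%N && is_record w i then z (letter w i)
     else y (letter w i)).
Proof.
elim: w M => [|a w IH] M; first by rewrite big_nil.
rewrite [size _]/= big_nat_recl //= andbT IH; congr (_ * _); apply: eq_bigr => i _.
by rewrite is_decrease_cons is_record_cons geq_max andbA.
Qed.

Lemma Yvar_prod_mcoeff (K : fieldType) (N : nat) (s m : seq nat) :
  sorted leq m -> all (gtn N) m ->
  (\prod_(u <- s) Yvar K N u)@_(mnm_of_seq N m) = (monom s == m)%:R.
Proof.
move=> srt mN; have [sN|sN] := boolP (all (gtn N) s).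
  have -> : \prod_(u <- s) Yvar K N u = 'X_[mnm_of_seq N s].
    elim: s sN => [_|a s IH /= /andP[aN sN]].
      by rewrite big_nil mnm_of_seq_nil mpolyX0.
    rewrite big_cons IH // -[a]/(val (Ordinal aN)) mnm_of_seq_cons mpolyXD.
    by rewrite Yvar_ord.
  rewrite mcoeffX mnm_of_seq_perm //; congr (nat_of_bool _)%:R.
  apply/idP/eqP => [e|<-]; last by rewrite perm_sym perm_sort.
  apply: (sorted_eq leq_trans anti_leq) => //; first exact: (sort_sorted leq_total).
  by rewrite perm_sort.
have [a sa aN] := allPn sN; rewrite (big_rem _ sa) /= Yvar_geq ?mul0r ?mcoeff0; last first.
  by rewrite leqNgt.
case: eqP => // e; case/negP: aN; apply: (allP mN).
by rewrite -e mem_sort.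
Qed.

Lemma words_widen (R : nmodType) (r0 r k : nat) (g : seq nat -> R) : (r0 <= r)%N ->
  (forall w, ~~ all (geq r0) w -> g w = 0) ->
  \sum_(w <- words r k) g w = \sum_(w <- words r0 k) g w.
Proof.
move=> r0r; elim: k g => [//|k IH] g hg; rewrite !big_wordsS.
rewrite (@big_cat_nat _ _ _ r0.+1) //= [X in _ + X]big_nat_cond [X in _ + X]big1 ?addr0.
  apply: eq_big_nat => a /andP[_ ar]; apply: IH => w hw; apply: hg.
  by rewrite /= negb_and hw orbT.
move=> a /andP[/andP[ra _] _]; rewrite big1 // => w _; apply: hg.
by rewrite /= negb_and -ltnNge ra.
Qed.

Section PartialSums.
Variable l : nat.
Hypothesis l0 : (0 < l)%N.

(** A letter above N * l contributes an index at least N: its quotient is at least N, and exceeds N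
    when it is a multiple of l, the only case where a decrease lowers the index. *)
Lemma psum_stable N r s : (N * l <= r)%N -> all (gtn N) s ->
  psum l r s = psum l (N * l) s.
Proof.
move=> hr sN; rewrite /psum [LHS]big_mkcond [RHS]big_mkcond.
apply: words_widen => // w /allPn[a aw]; rewrite /= -ltnNge => ha.
case: eqP => // e; exfalso.
have : wt_index l w (index a w) \in s.
  by rewrite -e mem_sort; apply: map_f; rewrite mem_iota index_mem.
move/(allP sN); rewrite /= /wt_index /letter nth_index // => {e}.
have d1 := divn_eq a l; have d2 := ltn_pmod a l0.
have hN : (N <= a %/ l)%N by rewrite leq_divRL // ltnW.
case: ifP => [/andP[_ /eqP a0]|_]; last by rewrite ltnNge hN.
have : (N < a %/ l)%N.
  by rewrite -(ltn_pmul2r l0) (leq_trans ha) // {1}d1 a0 addn0.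
by lia.
Qed.

Lemma size_psi_mon w : size (psi_mon l w) = size w.
Proof. by rewrite size_sort size_map size_iota. Qed.

Lemma word_weight_psi N w :
  word_weight (dec_weight N l (par_t l) (par_s l)) (inc_weight N l (par_s l))
    (rec_weight N l (par_r l) (par_s l)) 0 w =
  (psi_coef l w)%:MP *
  \prod_(u <- [seq wt_index l w i | i <- iota 0 (size w)]) Yvar _ N u.
Proof.
rewrite word_weightE /psi_coef rmorph_prod big_map /index_iota subn0 -big_split /=.
apply: eq_bigr => i _; rewrite /wt_coef /wt_index.
case: ifP => [/is_decrease_gt0 hi|_] /=.
  by rewrite /dec_weight gtn_eqF //; case: ifP.
case: ifP => _; first by rewrite /rec_weight; case: ifP.
by rewrite /inc_weight; case: ifP; rewrite ?mpolyC1 ?mul1r.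
Qed.

(** Each letter contributes exactly one variable, so only the words of length [size s] reach the
    monomial s. *)
Lemma represents_psum N r n :
  represents n (word_sum N l (par_t l) (par_r l) (par_s l) r n) (psum l r).
Proof.
move=> s srt sN sn; rewrite /word_sum raddf_sum /=.
rewrite (eq_bigr (fun k => \sum_(w <- words r k) psi_coef l w * (psi_mon l w == s)%:R)).
  rewrite big_mkord (bigD1 (Ordinal (sn : (size s < n.+1)%N))) //= [X in _ + X]big1 ?addr0.
    rewrite /psum [RHS]big_mkcond; apply: eq_bigr => w _.
    by case: eqP; rewrite ?mulr1 ?mulr0.
  move=> k hk; rewrite big_seq big1 // => w /size_words hw.
  case: eqP => [e|_]; last by rewrite mulr0.
  by case/eqP: hk; apply/val_inj; rewrite /= -hw -(size_psi_mon w) e.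
move=> k _; rewrite raddf_sum; apply: eq_bigr => w _.
by rewrite /= word_weight_psi mcoeffCM Yvar_prod_mcoeff.
Qed.
End PartialSums.

(* The limit F of the partial sums exists and F = numer / denom, stated as
   F * denom = numer (denom has constant term 1 - t, invertible). *)
Theorem theorem3p4 (l : nat) (hl : (1 <= l)%N) :
  exists F : series (Kfield l),
    series_lim (psum l) F /\ seq_eq (smul F (denom l)) (numer l).
Proof.
(* All indices in s are below [bnd s], so the coefficient of s is constant from r = bnd s * l on;
   this value defines F. *)
pose bnd (s : seq nat) := (\max_(a <- s) a).+1.
have bndP s : all (gtn (bnd s)) s.
  by apply/allP => a sa; rewrite /= ltnS; apply: leq_bigmax_seq.
have bnd_le N s : (0 < N)%N -> all (gtn N) s -> (bnd s <= N)%N.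
  move=> N0 /allP sN; rewrite /bnd big_seq.
  by elim/big_ind: _ => // a b; rewrite gtn_max => -> ->.
exists (fun s => psum l (bnd s * l) s); split=> [s _|s srt].
  by exists (bnd s * l)%N => r hr; apply: psum_stable.
pose N := bnd s; pose n := size s.
have hW : represents n (word_sum N l (par_t l) (par_r l) (par_s l) (N * l) n)
    (fun s => psum l (bnd s * l) s).
  (* F uses a different r for each monomial, but every s' in the first N variables has
     [bnd s' <= N], so r = N * l serves them all. *)
  move=> s' srt' sN' sn'; rewrite represents_psum //.
  by apply: psum_stable => //; rewrite leq_mul2r bnd_le // orbT.
apply: (represents_congr _ _ (@word_sum_quotient _ N l (par_t l) (par_r l) (par_s l) hl n)) => //.
- apply: representsM hW _; apply: representsD; last apply: representsN.
  + exact/representsZ/represents_hpoly.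
  + exact/representsZ/represents_hpoly.
- apply: representsM; first exact: represents_hpoly.
  apply: representsM; first exact: representsC.
  apply: represents_sprod => m; apply: representsM; last exact: represents_hpoly.
  exact: represents_epoly.
- exact: bndP.
Qed.
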